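(* There is a type 2 set $\Lambda$ such that for every admissible set $\Lambda'=\{\lambda'_0,\lambda'_1,\ldots\}$ the Minkowski sum $\Lambda+\Lambda'=\{\lambda+\lambda':\lambda\in\Lambda,\ \lambda'\in\Lambda'\}$ is type 2.
   Context: A set $\Lambda\subset\mathbb{R}$ is called admissible if it is countably infinite, unbounded, bounded from below, and has no finite accumulation points; type 1 and type 2 sets are by definition admissible. Let $\mu$ denote Lebesgue measure on $\mathbb{R}$. For an admissible $\Lambda$ and a (Lebesgue) measurable $f:\mathbb{R}\to[0,+\infty)$, put $s(x)=\sum_{\lambda\in\Lambda}f(x+\lambda)$, $C(f,\Lambda)=\{x\in\mathbb{R}: s(x)<\infty\}$ and $D(f,\Lambda)=\{x\in\mathbb{R}: s(x)=\infty\}$. The set $\Lambda$ is type 1 if for every measurable $f:\mathbb{R}\to[0,+\infty)$ either $\mu(D(f,\Lambda))=0$ or $\mu(C(f,\Lambda))=0$. Otherwise $\Lambda$ is type 2. *)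

(* Defs.v *)
From HB Require Import structures.
From mathcomp Require Import all_boot all_order all_algebra.
From mathcomp Require Import all_classical all_reals all_analysis.
Set Implicit Arguments.
Unset Strict Implicit.
Unset Printing Implicit Defensive.
Import Order.TTheory GRing.Theory Num.Theory.
Import numFieldNormedType.Exports.
Local Open Scope classical_set_scope.
Local Open Scope ring_scope.

Definition admissible (R : realType) (L : set R) : Prop :=
  [/\ countable L, infinite_set L, ~ bounded_set L, has_lbound L
    & limit_point L = set0].

(* The real line with the sigma-algebra of Lebesgue measurable sets (the
   Caratheodory sigma-algebra of the outer measure induced by interval length),
   as opposed to [measurableTypeR R], which carries the Borel sets.  It is the
   domain of [completed_lebesgue_measure]. *)
Definition lebesgueTypeR (R : realType) :=
  caratheodory_type (((@wlength R idfun)^*)%mu).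

Definition lebesgue_measurable_fun (R : realType) (f : R -> R) : Prop :=
  measurable_fun [set: lebesgueTypeR R] (f : lebesgueTypeR R -> measurableTypeR R).

Definition translate_sum (R : realType) (f : R -> R) (L : set R) (x : R) : \bar R :=
  (\esum_(l in L) (f (x + l))%:E)%E.

Definition conv_set (R : realType) (f : R -> R) (L : set R) : set R :=
  [set x | (translate_sum f L x < +oo)%E].

Definition div_set (R : realType) (f : R -> R) (L : set R) : set R :=
  [set x | translate_sum f L x = +oo%E].

(* [conv_set f L] and [div_set f L] are Lebesgue measurable whenever f is
   measurable and nonnegative and L is countable. *)
Definition type1 (R : realType) (L : set R) : Prop :=
  admissible L /\
  forall f : R -> R, lebesgue_measurable_fun f -> (forall x, 0 <= f x) ->
    completed_lebesgue_measure (div_set f L) = 0%E \/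
    completed_lebesgue_measure (conv_set f L) = 0%E.

Definition type2 (R : realType) (L : set R) : Prop :=
  admissible L /\ ~ type1 L.

Definition minkowski_sum (R : realType) (A B : set R) : set R :=
  [set a + b | a in A & b in B].

(* Main.v *)
Require Import Defs.
From mathcomp Require Import all_boot all_order all_algebra finmap.
From mathcomp Require Import zify ring lra.
From mathcomp Require Import all_classical all_reals all_analysis.
From mathcomp Require Import measurable_realfun.
Set Implicit Arguments.
Unset Strict Implicit.
Unset Printing Implicit Defensive.
Import Order.TTheory GRing.Theory Num.Theory.
Import numFieldNormedType.Exports.

(** The witness is Lambda = { sqrt (ln (k + 1)) : k in N }, which has about
    exp (t ^ 2) points below t.  Everything follows from a criterion on the
    counting function M(t) of an admissible set: if M grows faster than every
    exponential, the set is type 2.  Every sum Lambda + Lambda' contains a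
    translate of Lambda, so its counting function is superexponential as well,
    however sparse, dense or arithmetically structured Lambda' may be.

    The criterion.  If M(j + 1) <= C * M(j) held for all large j, M would be at
    most exponential; hence for every n there are arbitrarily large j such that
    p, the number of points in ]j, j + 1], exceeds 2 ^ n * M(j)
    ([jumps_of_superexponential]).  For such a j there is a set F in [j, j + 4[
    of measure at most 12 / p which is hit by x + P, P being those p points,
    for all x in a subset H of [0, 1[ of measure at least 1/2
    ([small_set_hit]): a random set of measure of order 1 / p would do, and the
    choice is made here by a covering argument on a finite bipartite graph
    ([bipartite_cover]).  On the other hand a point x of [4, 5[ can only be
    moved into F by one of the M(j) points below j, so that the set of such x
    that are moved into F at all has measure at most 12 * M(j) / p, hence at
    most 12 / 2 ^ n ([hit_and_miss]).

    Let f be the indicator of the union of the sets F_n obtained for n = 0, 1,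
    and so on.  The points of [0, 1[ that belong to infinitely many of the
    corresponding H_n form a set of measure at least 1/2, on which the sum
    diverges; by the Borel-Cantelli lemma almost
    every x of [4, 5[ is moved into finitely many F_n only, and there the sum is
    finite ([type2_of_jumps]). *)

(** * Covering half of a bipartite graph by few vertices *)

(** A random set of |S| / d vertices on the right would do.  Derandomized: take
    K maximal among the sets that cover at least d |T| / (2 |S|) vertices per
    element.  If more than half of T were still uncovered, double counting
    would give a vertex of S adjacent to at least d |T| / (2 |S|) uncovered
    ones, and it could be added to K. *)
Lemma bipartite_cover (S T : finType) (e : T -> S -> bool) (d : nat) :
  0 < d -> (forall x, d <= #|[set y | e x y]|) ->
  exists K : {set S}, d * #|K| <= 2 * #|S| /\
    #|T| <= 2 * #|[set x | [exists y in K, e x y]]|.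
Proof.
move=> d0 deg.
pose cov (K : {set S}) := [set x | [exists y in K, e x y]].
pose good (K : {set S}) := d * #|T| * #|K| <= 2 * #|S| * #|cov K|.
have [T0|T0] := posnP #|T|.
  by exists finset.set0; rewrite cards0 muln0 T0.
have good0 : good finset.set0 by rewrite /good cards0 muln0.
have [K maxK _] := @maxset_exists _ good finset.set0 good0.
have gK := maxsetp maxK.
exists K; split.
  rewrite -(leq_pmul2r T0) mulnAC.
  by apply: leq_trans gK _; rewrite leq_mul2l max_card orbT.
rewrite -/(cov K) leqNgt; apply/negP => few.
pose U := ~: cov K.
pose dU y := #|[set x in U | e x y]|.
have cU : #|cov K| + #|U| = #|T| by rewrite cardsC.
have sum_dU : d * #|U| <= \sum_y dU y.
  rewrite [leqRHS](_ : _ = \sum_(x in U) #|[set y | e x y]|).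
    rewrite mulnC -sum_nat_const.
    by apply: leq_sum => x _.
  under eq_bigr => y _ do rewrite /dU -sum1dep_card.
  under [RHS]eq_bigr => x _ do rewrite -sum1dep_card.
  rewrite (exchange_big_dep (mem U)) //=; last by move=> y x _ /andP[].
  by apply: eq_bigr => x xU; apply: eq_bigl => y; rewrite xU.
have [y hy] : exists y, d * #|U| <= #|S| * dU y.
  apply/existsP; apply/contraT; rewrite negb_exists => /forallP lt_dU.
  have : \sum_y (#|S| * dU y).+1 <= \sum_(y : S) d * #|U|.
    by apply: leq_sum => y _; rewrite ltnNge lt_dU.
  under eq_bigr => y _ do rewrite -addn1.
  rewrite big_split /= -big_distrr /= !sum_nat_const muln1.
  have dU_gt0 : 0 < d * #|U| by rewrite muln_gt0 d0; lia.
  have [S0|S0] := posnP #|S|; last first.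
    have : #|S| * (d * #|U|) <= #|S| * \sum_y dU y by rewrite leq_mul2l sum_dU orbT.
    by rewrite -[#|xpredT|]/#|S| => h1 h2; exfalso; move: (#|S| * _) h1 h2 => ?; lia.
  rewrite S0 !mul0n; move: (leq_trans dU_gt0 sum_dU).
  by rewrite big1 // => y _; have := fintype0 y S0.
have yK : y \notin K.
  apply/negP => yK.
  suff dy0 : dU y = 0 by nia.
  apply: eq_card0 => x; rewrite !inE.
  apply/negbTE; rewrite negb_and -implybE; apply/implyP.
  by apply: contra => exy; apply/existsP; exists y; rewrite yK.
have cov_y : #|cov K| + dU y <= #|cov (y |: K)|.
  rewrite /dU -cardsUI (_ : _ :&: _ = finset.set0) ?cards0 ?addn0.
    apply: subset_leq_card; apply/fintype.subsetP => x; rewrite !inE.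
    case/orP => [/existsP[z /andP[zK exz]]|/andP[_ exy]]; apply/existsP.
      by exists z; rewrite !inE zK orbT.
    by exists y; rewrite !inE eqxx.
  by apply/finset.setP => x; rewrite !inE; case: [exists z in K, e x z].
have gyK : good (y |: K).
  by rewrite /good cardsU1 yK; move: gK; rewrite /good; nia.
by move: yK; rewrite -(maxsetsup maxK gyK (finset.subsetU1 y K)) finset.setU11.
Qed.

Local Open Scope classical_set_scope.
Local Open Scope ring_scope.

(** * Admissible sets *)

(** Bolzano-Weierstrass: infinitely many points below t would accumulate. *)
Lemma admissible_finite_below (R : realType) (L : set R) (t : R) :
  admissible L -> finite_set (L `&` [set x | x <= t]).
Proof.
move=> [_ _ _ [b lb_b] noacc]; apply: contrapT => infLt.
have bndLt : bounded_set (L `&` [set x | x <= t]).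
  exists (`|b| + `|t|); split => // r br x [Lx xt].
  have bx := lb_b x Lx; rewrite /= in xt.
  apply: (le_trans _ (ltW br)); rewrite ler_norml.
  by have := ler_norm t; have := ler_norm (- b); rewrite normrN;
     have := normr_ge0 b; have := normr_ge0 t; move=> ? ? ? ?; apply/andP; split; lra.
have [x accx] := infinite_bounded_limit_point_nonempty infLt bndLt.
suff : limit_point L x by rewrite noacc.
by move=> U /accx[y [yx [Ly _] Uy]]; exists y.
Qed.

Lemma admissible_of_finite_below (R : realType) (L : set R) :
  infinite_set L -> has_lbound L ->
  (forall t, finite_set (L `&` [set x | x <= t])) -> admissible L.
Proof.
move=> infL lbL finL; split => //.
- rewrite (_ : L = \bigcup_(n in [set: nat]) (L `&` [set x | x <= n%:R])).
    apply: bigcup_countable => [|n _]; first exact: countableP.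
    exact: finite_set_countable.
  apply/seteqP; split => [x Lx|x [n _ []//]].
  exists (Num.bound `|x|) => //; split => //=.
  by rewrite (le_trans (ler_norm _)) // ltW // archi_boundP.
- move=> [M [_ LM]]; apply: infL.
  rewrite (_ : L = L `&` [set x | x <= M + 1]); first exact: finL.
  apply/seteqP; split => [x Lx|x []//]; split => //=.
  by apply: le_trans (ler_norm _) (LM _ _ _ Lx); rewrite ltrDl.
- apply/seteqP; split => // x /limit_point_infinite_setP acc.
  have : nbhs x [set y | y < x + 1] by apply: open_nbhs_nbhs; split; [exact: open_lt|rewrite /= ltrDl].
  move=> /acc; apply; apply: sub_finite_set (finL (x + 1)).
  by move=> y [/= yx Ly]; split => //=; exact: ltW.
Qed.

(** * A small set hit by most translates of a finite set *)

(** A union of windows of w consecutive cells of the grid of mesh 1 / q that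
    starts at t.  Only w = 1 and w = 2 occur: the longer windows absorb the error
    made when a point is rounded down to the grid. *)
Definition cells (R : realType) (q w : nat) (t : R) (m : nat) (K : {set 'I_m}) : set R :=
  \bigcup_(k in [set` K]) `[t + k%:R / q%:R, t + (k + w)%:R / q%:R[%classic.

Section cells.
Variables (R : realType) (q : nat) (q0 : (0 < q)%N).
Local Notation mu := (@lebesgue_measure R).

Lemma measurable_cells w (t : R) m (K : {set 'I_m}) :
  measurable (cells q w t K : set (measurableTypeR R)).
Proof. by apply: fin_bigcup_measurable => // k _; exact: measurable_itv. Qed.

Lemma lebesgue_measure_cell w (t : R) (k : nat) :
  mu `[t + k%:R / q%:R, t + (k + w)%:R / q%:R[%classic = (w%:R / q%:R)%:E.
Proof.
have q_gt0 : 0 < q%:R :> R by rewrite ltr0n.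
rewrite lebesgue_measure_itv /= lte_fin ltrD2l ltr_pM2r ?invr_gt0// ltr_nat.
case: ltnP => [_|]; first by rewrite -EFinB natrD; congr (_%:E); ring.
by rewrite -{2}(addn0 k) leq_add2l leqn0 => /eqP ->; rewrite mul0r.
Qed.

Lemma sum_lebesgue_measure_cell w (t : R) m (K : {set 'I_m}) :
  (\sum_(k \in [set` K]) mu `[(t + (k : nat)%:R / q%:R)%R, (t + (k + w)%:R / q%:R)%R[%classic
   = ((#|K| * w)%:R / q%:R)%R%:E)%E.
Proof.
under eq_fsbigr do rewrite lebesgue_measure_cell.
rewrite (_ : [set` K] = [set` enum K]); last first.
  by apply/seteqP; split => k /=; rewrite mem_enum.
rewrite -fsbig_seq ?enum_uniq// big_enum /= sumEFin sumr_const.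
by rewrite -mulr_natr natrM; congr EFin; ring.
Qed.

Lemma lebesgue_measure_cells_le w (t : R) m (K : {set 'I_m}) :
  (mu (cells q w t K) <= ((#|K| * w)%:R / q%:R)%R%:E)%E.
Proof.
rewrite -(sum_lebesgue_measure_cell w t); apply: content_sub_fsum => //.
exact: measurable_cells.
Qed.

Lemma lebesgue_measure_cells1 (t : R) m (K : {set 'I_m}) :
  mu (cells q 1 t K) = (#|K|%:R / q%:R)%:E.
Proof.
rewrite [LHS]measure_fin_bigcup//.
  by rewrite sum_lebesgue_measure_cell muln1.
move=> i j _ _ [x [/=]]; rewrite !in_itv /= => /andP[ix xi] /andP[jx xj].
have q_gt0 : 0 < q%:R^-1 :> R by rewrite invr_gt0 ltr0n.
have le_index (a b : nat) :
    t + a%:R / q%:R <= x -> x < t + (b + 1)%:R / q%:R -> (a <= b)%N.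
  move=> ax xb; have := le_lt_trans ax xb.
  by rewrite ltrD2l ltr_pM2r // ltr_nat addn1 ltnS.
by apply/val_inj/eqP; rewrite /= eqn_leq (le_index _ _ ix xj) (le_index _ _ jx xi).
Qed.
End cells.

(** Gives a grid finer than every gap of a finite set. *)
Lemma archimedean_seq (R : realType) (s : seq R) : all (fun x => 0 < x) s ->
  exists2 q : nat, (0 < q)%N & all (fun x => 1 <= q%:R * x) s.
Proof.
elim: s => [|x s IH] /=; first by exists 1%N.
case/andP => x0 /IH[q q0 qs].
pose r := Num.bound x^-1.
have rx : 1 <= r%:R * x.
  by rewrite -ler_pdivrMr // div1r ltW // archi_boundP // invr_ge0 ltW.
exists (q + r)%N; first by rewrite addn_gt0 q0.
rewrite natrD; apply/andP; split.
  by rewrite mulrDl (le_trans rx)// lerDr mulr_ge0 // ltW.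
apply/allP => y ys; have /allP/(_ y ys) qy := qs.
have y0 : 0 <= y.
  by move: qy; rewrite -(@pmulr_rge0 _ q%:R) ?ltr0n//; exact: le_trans.
by rewrite mulrDl (le_trans qy)// lerDl mulr_ge0.
Qed.

Lemma cells_translate (R : realType) (q w : nat) (t u : R) m (K : {set 'I_m}) :
  [set x | cells q w t K (x + u)] = cells q w (t - u) K.
Proof.
apply/seteqP; split=> x [k kK] /=; rewrite in_itv /= => /andP[kx xk];
  exists k => //=; rewrite in_itv /=; apply/andP; split; lra.
Qed.

(** On a grid finer than every gap of P, distinct points fall into distinct
    cells. *)
Lemma separated_truncn (R : realType) (P : seq R) (t : R) :
  (forall l, l \in P -> t < l) ->
  exists2 q : nat, (0 < q)%N &
    {in P &, injective (fun l => Num.truncn (q%:R * (l - t)))}.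
Proof.
move=> tP.
pose gaps := [seq `|l.1 - l.2| | l <- [seq l <- [seq (l, l') | l <- P, l' <- P] | l.1 != l.2]].
have gaps_gt0 : all (fun x => 0 < x) gaps.
  apply/allP => _ /mapP[[l l'] + ->]; rewrite mem_filter /= => /andP[ll' _].
  by rewrite normr_gt0 subr_eq0.
have [q q0 /allP gap_q] := archimedean_seq gaps_gt0; exists q => //.
move=> l l' lP l'P /= eq_trunc; apply/eqP; apply: contraT => ll'.
have gap : 1 <= q%:R * `|l - l'|.
  apply: gap_q; apply/mapP; exists (l, l') => //.
  by rewrite mem_filter /= ll'; apply/allpairsP; exists (l, l').
have scaled_ge0 x : x \in P -> 0 <= q%:R * (x - t).
  by move=> /tP tx; rewrite mulr_ge0 // subr_ge0 ltW.
have /andP[a1 a2] := truncn_itv (scaled_ge0 l lP).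
have /andP[b1 b2] := truncn_itv (scaled_ge0 l' l'P).
rewrite -eq_trunc in b1 b2.
have : q%:R * `|l - l'| < 1.
  rewrite -[X in X * _]ger0_norm // -normrM ltr_norml.
  move: a1 a2 b1 b2; rewrite -natr1 !mulrBr => ? ? ? ?.
  by apply/andP; split; lra.
by rewrite ltNge gap.
Qed.

(** On a fine grid, a point l of P is given by its cell number a(l).  Join the
    cell j of [0, 1[ to the numbers j + a(l): every cell has |P| neighbours among
    2 q + 1 numbers, so about 4 q / |P| of the numbers suffice to cover half of
    the cells.  If x lies in the cell j, then x + l lies in the cell j + a(l) or
    in the next one, whence the windows of length 2 in F.  The measure of F is
    bounded along all its translates, which serves to bound the set of points
    that other elements move into F. *)
Lemma small_set_hit (R : realType) (P : seq R) (t : R) :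
  uniq P -> (0 < size P)%N -> (forall l, l \in P -> t < l <= t + 1) ->
  exists F H : set R,
   [/\ forall u, measurable ([set x | F (x + u)] : set (measurableTypeR R)),
       forall u, (lebesgue_measure [set x | F (x + u)%R] <= (12 / (size P)%:R)%R%:E)%E
     & F `<=` [set x | t <= x < t + 4] ] /\
   [/\ measurable (H : set (measurableTypeR R)),
       H `<=` [set x | 0 <= x < 1],
       ((2^-1)%R%:E <= lebesgue_measure H)%E
     & forall x, H x -> exists2 l, l \in P & F (x + l)].
Proof.
move=> uP P0 tP.
have [|q q0 inj_a] := @separated_truncn R P t; first by move=> l /tP/andP[].
pose a l := Num.truncn (q%:R * (l - t)).
have q_gt0 : 0 < q%:R :> R by rewrite ltr0n.
have a_ge0 l : l \in P -> 0 <= q%:R * (l - t).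
  by move=> /tP/andP[tl _]; rewrite mulr_ge0 // subr_ge0 ltW.
have a_le l : l \in P -> (a l <= q)%N.
  move=> lP; rewrite /a -(ler_nat R); apply: le_trans (_ : q%:R * (l - t) <= _).
    by have /andP[] := truncn_itv (a_ge0 l lP).
  by rewrite ler_piMr //; have /andP[_] := tP l lP; lra.
pose e (j : 'I_q) (k : 'I_(q + q).+1) := has (fun l => k == j + a l :> nat)%N P.
have deg j : (size P <= #|[set k | e j k]%SET|)%N.
  pose f l : 'I_(q + q).+1 := inord (j + a l).
  have fE l : l \in P -> f l = (j + a l)%N :> nat.
    move=> lP; rewrite inordK // ltnS leq_add ?a_le //.
    exact: ltnW.
  rewrite -(size_map f) -(card_uniqP _); last first.
    rewrite map_inj_in_uniq // => l l' lP l'P /(congr1 val) /=.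
    rewrite fE // fE // => /addnI; exact: inj_a.
  apply: subset_leq_card; apply/fintype.subsetP => _ /mapP[l lP ->].
  by rewrite inE; apply/hasP; exists l => //; rewrite fE.
have [K [cardK covK]] := bipartite_cover P0 deg.
rewrite !card_ord in cardK covK.
set J := [set _ | _]%SET in covK.
exists (cells q 2 t K), (cells q 1 0 J); split; split.
- by move=> u; rewrite cells_translate; exact: measurable_cells.
- move=> u; rewrite cells_translate.
  apply: le_trans (lebesgue_measure_cells_le q0 _ _ _) _.
  rewrite lee_fin ler_pdivrMr // mulrAC ler_pdivlMr ?ltr0n //.
  (* The constant: |K| |P| <= 2 (2 q + 1) <= 6 q, with windows of two cells. *)
  rewrite -!natrM ler_nat mulnAC (mulnC #|K|).
  by move: (size P * _)%N cardK => c; lia.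
- move=> x [k _] /=; rewrite in_itv /= => /andP[kx xk]; apply/andP; split.
    by apply: le_trans kx; rewrite lerDl divr_ge0.
  (* The last window ends at t + (2 q + 2) / q. *)
  apply: lt_le_trans xk _; rewrite lerD2l ler_pdivrMr //.
  by rewrite -natrM ler_nat; have := ltn_ord k; lia.
- exact: measurable_cells.
- move=> x [k _] /=; rewrite in_itv /= !add0r => /andP[kx xk]; apply/andP; split.
    by apply: le_trans kx; rewrite divr_ge0.
  apply: lt_le_trans xk _; rewrite ler_pdivrMr // mul1r.
  by rewrite ler_nat; have := ltn_ord k; lia.
- rewrite lebesgue_measure_cells1 // lee_fin ler_pdivlMr // ler_pdivrMl //.
  by rewrite -natrM ler_nat.
move=> x [j]; rewrite /= inE => /existsP[k /andP[kK /hasP[l lP /eqP kE]]].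
rewrite in_itv /= !add0r => /andP[jx xj].
exists l => //; exists k => //=; rewrite in_itv /= kE.
have /andP[la al] := truncn_itv (a_ge0 l lP).
rewrite -/(a l) in la al.
have al' : (a l)%:R / q%:R <= l - t by rewrite ler_pdivrMr // mulrC.
have la' : l - t < (a l).+1%:R / q%:R by rewrite ltr_pdivlMr // mulrC.
rewrite !natrD !mulrDl; rewrite natrD !mulrDl in xj.
by rewrite -natr1 mulrDl in la'; apply/andP; split; lra.
Qed.

(** * Jumps of the counting function *)

Definition count_below (R : realType) (L : set R) (j : nat) : nat :=
  #|` fset_set (L `&` [set x | x <= j%:R])|%fset.

(** The factor 2 ^ n + 1 leaves more than 2 ^ n M(j) new points in ]j, j + 1],
    to which [small_set_hit] applies.  A point at the right of 4 is only moved
    into F by elements below j, as F lies below j + 4; so B can be taken as a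
    union of M(j) translates of F, whose measure the new points, being so much
    more numerous, make small. *)
Lemma hit_and_miss (R : realType) (L : set R) (n j : nat) :
  admissible L -> ((2 ^ n).+1 * count_below L j < count_below L j.+1)%N ->
  exists F H B : set (measurableTypeR R),
    [/\ measurable F, measurable H, measurable B,
        (2^-1%R%:E <= lebesgue_measure H)%E
      & (lebesgue_measure B <= (12 / 2 ^+ n)%R%:E)%E] /\
    [/\ F `<=` [set x | j%:R <= x < j%:R + 4], H `<=` [set x | 0 <= x < 1],
        forall x, H x -> exists l, [/\ L l, j%:R < l & F (x + l)]
      & forall x l, 4 <= x -> L l -> F (x + l) -> B x].
Proof.
move=> admL jump.
have finL := admissible_finite_below _ admL.
pose A i := fset_set (L `&` [set x | x <= i%:R]).
have AE i x : (x \in A i) = (x \in L `&` [set x | x <= i%:R]).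
  by rewrite /A in_fset_set.
pose P := (A j.+1 `\` A j)%fset.
have sizeP : (2 ^ n * count_below L j < size P)%N.
  have : (#|` A j.+1 `&` A j| <= #|` A j|)%fset%N.
    exact/fsubset_leq_card/fsubsetIr.
  rewrite -[size P]/(#|` A j.+1 `\` A j|)%fset cardfsD.
  by move: jump; rewrite -!/(#|` A _|)%fset /count_below -!/(A _) mulSn; lia.
have PP l : l \in P -> L l /\ j%:R < l <= j%:R + 1.
  rewrite in_fsetD !AE => /andP[/negP nlj /set_mem[Ll /= lj]]; split => //.
  rewrite natr1 lj andbT ltNge; apply/negP => l_le.
  by apply: nlj; apply/mem_set; split.
have P0 : (0 < size P)%N by apply: leq_ltn_trans sizeP.
have [F [H [[mF muF Fj] [mH H01 muH hitH]]]] :=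
  small_set_hit (fset_uniq P) P0 (fun l lP => (PP l lP).2).
pose B := \bigcup_(l in L `&` [set x | x <= j%:R]) [set x | F (x + l)].
have mB : measurable (B : set (measurableTypeR R)).
  by apply: fin_bigcup_measurable => // l _; exact: mF.
exists F, H, B; do !split => //.
- by have := mF 0; under eq_set do rewrite addr0.
- apply: (@le_trans _ _ (\sum_(l \in L `&` [set x | (x <= j%:R)%R])
    lebesgue_measure [set x | F (x + l)%R])%E).
    by apply: content_sub_fsum => // l _; exact: mF.
  rewrite fsbig_finite //=.
  apply: le_trans (lee_sum _ (fun l _ => muF l)) _.
  rewrite sumEFin big_const_seq count_predT iter_addr_0 lee_fin.
  rewrite -/(count_below L j) -[leLHS]mulr_natr mulrAC ler_pdivrMr ?ltr0n //.
  rewrite mulrAC ler_pdivlMr ?exprn_gt0 // -natrX -!natrM ler_nat.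
  by rewrite -mulnA leq_mul2l /= mulnC ltnW.
- by move=> x /hitH[l lP Fxl]; have [Ll /andP[jl _]] := PP l lP; exists l.
move=> x l x4 Ll Fxl; exists l => //; split => //=.
by have /= /andP[_] := Fj _ Fxl; lra.
Qed.

Lemma translate_sum_indic (R : realType) (F L : set R) (x : R) :
  translate_sum (\1_F) L x = (\esum_(l in L `&` [set l | F (x + l)%R]) 1)%E.
Proof.
rewrite esum_mkcondr; apply: eq_esum => l _.
have FE : (x + l \in F) = (l \in [set l | F (x + l)]).
  by apply/idP/idP => /set_mem ?; apply/mem_set.
by rewrite indicE FE; case: (l \in _).
Qed.

Lemma conv_set_indic (R : realType) (F L : set R) (x : R) :
  finite_set (L `&` [set l | F (x + l)]) -> conv_set (\1_F) L x.
Proof.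
move=> finLF; rewrite /conv_set /= translate_sum_indic.
by rewrite (@finite_card_sum _ (measurableTypeR R)) // ltry.
Qed.

Lemma div_set_indic (R : realType) (F L : set R) (x : R) :
  infinite_set (L `&` [set l | F (x + l)]) -> div_set (\1_F) L x.
Proof.
move=> infLF; rewrite /div_set /= translate_sum_indic.
rewrite -(@infinite_card_dirac _ (measurableTypeR R) R _ infLF).
by apply: eq_esum => l Fl; rewrite diracE mem_set.
Qed.

(** Both alternatives of type 1 fail for the indicator of the union of the F_n:
    the limsup of the H_n lies in the divergence set and has measure at least
    1/2, and the limsup of the B_n is null while [4, 5[ minus this limsup lies in
    the convergence set.  Measures are compared through the outer measure that
    the completed measure restricts, which is monotone on all sets. *)
Lemma type2_of_jumps (R : realType) (L : set R) :
  admissible L ->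
  (forall n, exists2 j, (n <= j)%N & ((2 ^ n).+1 * count_below L j < count_below L j.+1)%N) ->
  type2 L.
Proof.
move=> admL jumps; split => // -[_ type1L].
have /choice[j_ jP] : forall n, exists j : nat,
    (n <= j)%N /\ ((2 ^ n).+1 * count_below L j < count_below L j.+1)%N.
  by move=> n; have [j] := jumps n; exists j.
have /choice[F sceneF] n := hit_and_miss admL (jP n).2.
have {sceneF} /choice[H sceneH] := sceneF.
have {sceneH} /choice[B scene] := sceneH.
pose G := \bigcup_n F n.
have mF n : measurable (F n) by have [[]] := scene n.
have mH n : measurable (H n) by have [[]] := scene n.
have mB n : measurable (B n) by have [[]] := scene n.
have muH n : (2^-1%R%:E <= lebesgue_measure (H n))%E by have [[]] := scene n.
have muB n : (lebesgue_measure (B n) <= (12 / 2 ^+ n)%R%:E)%E by have [[]] := scene n.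
have mG : measurable (G : set (measurableTypeR R)) by exact: bigcupT_measurable.
have indicG : lebesgue_measurable_fun (\1_G : R -> R).
  apply: measurable_indic; exact: sub_caratheodory.
(* An element moving x into F_n with n >= N exceeds j_n >= N, so infinitely
   many n require infinitely many elements. *)
have divH : lim_sup_set H `<=` div_set (\1_G) L.
  move=> x limH; apply: div_set_indic => finL.
  have [M [_ boundM]] := compact_bounded (finite_compact finL).
  pose N := Num.bound (`|M| + 1).
  have [n /= Nn Hnx] := limH N I.
  have [_ [_ _ /(_ _ Hnx)[l [Ll jl Fl]] _]] := scene n.
  have : `|l| <= `|M| + 1.
    apply: boundM; last by split => //; exists n.
    by apply: le_lt_trans (ler_norm M) _; rewrite ltrDl.
  move=> /(le_trans (ler_norm l)); apply/negP; rewrite -ltNge.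
  apply: lt_trans jl; apply: lt_le_trans (archi_boundP _) _.
    by rewrite addr_ge0.
  by rewrite ler_nat (leq_trans Nn) // (jP n).1.
have convB : `[4, 5[ `\` lim_sup_set B `<=` conv_set (\1_G) L.
  move=> x [/=]; rewrite in_itv /= => /andP[x4 x5] nlimB; apply: conv_set_indic.
  have [N BN] : exists N, forall n, (N <= n)%N -> ~ B n x.
    apply: contrapT => /forallNP Bfreq; apply: nlimB => N _.
    apply: contrapT => noB; apply: (Bfreq N) => n Nn Bnx.
    by apply: noB; exists n.
  apply: (@sub_finite_set _ _
    (\bigcup_(n in `I_N) (L `&` [set l | l <= (j_ n)%:R]))); last first.
    by apply: bigcup_finite => // n _; exact: admissible_finite_below.
  move=> l [Ll [n _ Fnl]]; have [_ [Fj _ _ FB]] := scene n.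
  exists n => /=.
    by rewrite ltnNge; apply/negP => /BN; apply; exact: FB Fnl.
  by split => //=; have /= /andP[_] := Fj _ Fnl; lra.
have muHdiv : (2^-1%R%:E <= lebesgue_measure (lim_sup_set H))%E.
  apply: (cvge_ge _ (lim_sup_set_cvg lebesgue_measure H mH _)).
    apply: nearW => n; apply: le_trans (muH n) _.
    apply: le_measure; rewrite ?inE //; first exact: bigcup_measurable.
    by move=> x Hx; exists n => /=.
  apply: (@le_lt_trans _ _ (lebesgue_measure (`[0, 1[%classic : set R))).
    apply: le_measure; rewrite ?inE //; first exact: bigcup_measurable.
    move=> x [n _ Hnx]; have [_ [_ H01 _ _]] := scene n.
    by rewrite /= in_itv /=; exact: H01 Hnx.
  by rewrite lebesgue_measure_itv /= lte_fin ltr01 -EFinB ltry.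
have muB0 : lebesgue_measure (lim_sup_set B) = 0%E.
  apply: lim_sup_set_cvg0 => //.
  (* 12 / 2 ^ n is written 24 / 2 ^ (n + 1) to sum the geometric series. *)
  apply: (@le_lt_trans _ _ 24%:E); last exact: ltry.
  apply: le_trans _ (epsilon_trick0 xpredT _) => //.
  apply: lee_nneseries => // n _; apply: le_trans (muB n) _.
  by rewrite lee_fin natrX exprS invfM mulrA ler_pM2r ?invr_gt0 ?exprn_gt0 //; lra.
have [div0|conv0] := type1L _ indicG (fun x => ltac:(by rewrite indicE)).
  have := le_trans muHdiv (le_outer_measure ((wlength idfun)^*)%mu _ _ divH).
  by rewrite [X in (_ <= X)%E]div0 lee_fin leNgt invr_gt0 ltr0n.
have mA : measurable (`[4, 5[ `\` lim_sup_set B : set (measurableTypeR R)).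
  apply: measurableD => //; apply: bigcap_measurable => // n _.
  exact: bigcup_measurable.
have A0 : lebesgue_measure (`[4, 5[ `\` lim_sup_set B : set R) = 0%E.
  apply/eqP; rewrite eq_le measure_ge0 andbT -[leRHS]conv0.
  exact: (le_outer_measure ((wlength idfun)^*)%mu _ _ convB).
have : (lebesgue_measure (`[4%R, 5%R[%classic : set R) <= 0)%E.
  rewrite -(adde0 0%E) -[X in (_ <= X + _)%E]A0 -[X in (_ <= _ + X)%E]muB0.
  apply: le_trans (measureU2 _ _ _) => //.
    apply: le_measure; rewrite ?inE //.
      apply: measurableU => //; apply: bigcap_measurable => // n _.
      exact: bigcup_measurable.
    by move=> y Ay; have [By|nBy] := pselect (lim_sup_set B y); [right|left].
  by apply: bigcap_measurable => // n _; exact: bigcup_measurable.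
by rewrite lebesgue_measure_itv /= lte_fin ltr_nat /= -EFinB lee_fin; lra.
Qed.

(** * Superexponential counting functions *)

(** Without jumps from n on, M(n + i) would be at most 2 ^ ((n + 1) i) M(n),
    which a Gaussian lower bound excludes, even one delayed by c. *)
Lemma jumps_of_superexponential (M : nat -> nat) (c : nat) :
  (forall j, 2 ^ (j ^ 2) <= M (j + c))%N ->
  forall n, exists2 j, (n <= j)%N & ((2 ^ n).+1 * M j < M j.+1)%N.
Proof.
move=> growth n; apply: contrapT => /forall2NP nojump.
have step j : (n <= j)%N -> (M j.+1 <= 2 ^ n.+1 * M j)%N.
  move=> nj; have [//|/negP] := nojump j; rewrite -leqNgt => /leq_trans; apply.
  by rewrite leq_mul2r expnS mul2n -addnn -addn1 leq_add2l expn_gt0 orbT.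
have bound i : (M (n + i) <= 2 ^ (n.+1 * i) * M n)%N.
  elim: i => [|i IH]; first by rewrite addn0 muln0 expn0 mul1n.
  rewrite addnS (leq_trans (step _ (leq_addr _ _))) //.
  by rewrite mulnS expnD -mulnA leq_mul2l IH orbT.
(* Chosen so that j ^ 2 > (n + 1) (j + c) + M n. *)
have [j jE] : exists j, j = (n.+1 + n.+1 * c + M n + n.+1)%N by eexists.
have := growth j; have -> : (j + c = n + (j + c - n))%N by lia.
move=> /leq_trans/(_ (bound _)); apply/negP; rewrite -ltnNge.
apply: (@leq_ltn_trans (2 ^ (n.+1 * (j + c)) * 2 ^ M n)%N).
  apply: leq_mul; last exact/ltnW/ltn_expl.
  by rewrite leq_exp2l // leq_mul2l; apply/orP; right; lia.
have j0 : (0 < j)%N by lia.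
have jj : (j ^ 2 = n.+1 * j + n.+1 * c * j + M n * j + n.+1 * j)%N.
  by rewrite expnS expn1 {1}jE !mulnDl.
rewrite -expnD ltn_exp2l // jj mulnDr.
have : (n.+1 * c <= n.+1 * c * j)%N by rewrite leq_pmulr.
have : (M n <= M n * j)%N by rewrite leq_pmulr.
have : (0 < n.+1 * j)%N by rewrite muln_gt0.
by move: (n.+1 * c * j)%N (M n * j)%N (n.+1 * j)%N (n.+1 * c)%N => *; lia.
Qed.

(** A set with about exp (t ^ 2) points below t. *)
Definition sqrt_log_set (R : realType) : set R :=
  range (fun k : nat => Num.sqrt (ln k.+1%:R)).

Arguments sqrt_log_set : clear implicits.

Lemma sqrt_log_le (R : realType) (k : nat) (t : R) : 0 <= t ->
  (Num.sqrt (ln k.+1%:R) <= t) = (k.+1%:R <= expR (t ^+ 2)).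
Proof.
move=> t0.
have ln0 : 0 <= ln k.+1%:R :> R by rewrite ln_ge0 // ler1n.
rewrite -[t in LHS]ger0_norm // -sqrtr_sqr ler_sqrt ?sqr_ge0//.
by rewrite -[leRHS]expRK ler_ln ?posrE ?ltr0n ?expR_gt0.
Qed.

Lemma sqrt_log_inj (R : realType) :
  injective (fun k : nat => Num.sqrt (ln k.+1%:R) : R).
Proof.
move=> k k' /(congr1 (fun x => x ^+ 2)) /=.
rewrite !sqr_sqrtr ?ln_ge0 ?ler1n // => /ln_inj.
by rewrite !posrE !ltr0n => /(_ isT isT)/eqP; rewrite eqr_nat => /eqP [].
Qed.

Lemma sqrt_log_set_finite_below (R : realType) (t : R) :
  finite_set (sqrt_log_set R `&` [set x | x <= t]).
Proof.
(* t may be negative, and then only its positive part can be squared. *)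
pose N := Num.bound (expR (Num.max t 0 ^+ 2)).
apply: (@sub_finite_set _ _ ((fun k : nat => Num.sqrt (ln k.+1%:R)) @` `I_N)); last first.
  exact: finite_image.
move=> x [[k _ <-] /= kt]; exists k => //=.
have : Num.sqrt (ln k.+1%:R) <= Num.max t 0 :> R by rewrite le_max kt.
rewrite sqrt_log_le ?le_max ?lexx ?orbT // => /le_lt_trans kN.
have := kN _ (archi_boundP (expR_ge0 _)).
by rewrite ltr_nat; exact: ltnW.
Qed.

Lemma admissible_sqrt_log (R : realType) : admissible (sqrt_log_set R).
Proof.
apply: admissible_of_finite_below; last exact: sqrt_log_set_finite_below.
  rewrite (eq_finite_set (inj_card_eq (in2W (@sqrt_log_inj R)))).
  exact: infinite_nat.
by exists 0 => _ [k _ <-]; exact: sqrtr_ge0.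
Qed.

(** The property of the witness that survives the sum with any other set. *)
Lemma type2_of_sqrt_log_translate (R : realType) (L : set R) (c : R) :
  admissible L -> (forall x, sqrt_log_set R x -> L (x + c)) -> type2 L.
Proof.
move=> admL subL; apply: type2_of_jumps => //.
apply: (@jumps_of_superexponential _ (Num.bound `|c|)) => j.
rewrite /count_below.
set N := (2 ^ _)%N.
apply: leq_card_fset_set; first exact: admissible_finite_below.
pose g k : R := Num.sqrt (ln k.+1%:R) + c.
have inj_g : injective g by move=> k k' /addIr/sqrt_log_inj.
rewrite -(card_le_eql (inj_card_eq (in2W inj_g))).
apply: subset_card_le => _ [k /= kN <-]; split; first by apply: subL; exists k.
rewrite natrD lerD //=; last first.
  by rewrite (le_trans (ler_norm _)) // ltW // archi_boundP.
rewrite sqrt_log_le // -natrX -[X in expR X]mulr1 expRM_natl.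
apply: (@le_trans _ _ (2 ^+ (j ^ 2))); first by rewrite -natrX ler_nat.
apply: lerXn2r; rewrite ?nnegrE ?expR_ge0 //.
exact: expR_ge1Dx.
Qed.

Lemma admissible_minkowski_sum (R : realType) (A B : set R) :
  admissible A -> admissible B -> admissible (minkowski_sum A B).
Proof.
move=> admA admB.
have [_ infA _ [a lbA] _] := admA; have [_ infB _ [b lbB] _] := admB.
apply: admissible_of_finite_below.
- have [y By] := infinite_setN0 infB.
  have translateA : (fun x => x + y) @` A `<=` minkowski_sum A B.
    by move=> _ [x Ax <-]; exists x => //; exists y.
  apply: sub_infinite_set translateA _.
  by rewrite (eq_finite_set (inj_card_eq (in2W (@addIr _ y)))).
- exists (a + b) => _ [x Ax [y By <-]]; apply: lerD; [exact: lbA|exact: lbB].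
move=> t.
apply: (@sub_finite_set _ _ [set x + y | x in A `&` [set x | x <= t - b] &
                                         y in B `&` [set y | y <= t - a]]).
  move=> _ [[x Ax [y By <-]] /= xyt].
  have := lbA _ Ax; have := lbB _ By => bley alex.
  by exists x; [split => //=; lra|exists y => //; split => //=; lra].
by apply: finite_image2; exact: admissible_finite_below.
Qed.

Theorem proposition4p4 (R : realType) :
  exists L : set R, type2 L /\
    forall L' : set R, admissible L' -> type2 (minkowski_sum L L').
Proof.
exists (sqrt_log_set R); split.
  apply: (@type2_of_sqrt_log_translate _ _ 0); first exact: admissible_sqrt_log.
  by move=> x; rewrite addr0.
move=> L' admL'; have [_ infL' _ _ _] := admL'.
have [c L'c] := infinite_setN0 infL'.
apply: (@type2_of_sqrt_log_translate _ _ c).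
  by apply: admissible_minkowski_sum => //; exact: admissible_sqrt_log.
by move=> x Lx; exists x => //; exists c.
Qed.
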